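(* Let $\tau=k\tau_2\cdots\tau_k\in S_k$ (i.e., $\tau_1=k$). For every real $\delta$ with $0<\delta<1/L(\tau)$, $$\limsup_{n\to\infty}|S_n(\tau;\mathrm{LR}_n<\delta n)|^{1/n}<L(\tau).$$
   Context: $S_n(\tau)$ is the set of permutations of $[n]$ avoiding $\tau$, and $L(\tau)=\lim_{n\to\infty}|S_n(\tau)|^{1/n}$ (which exists and is finite). $\mathrm{LR}_n(\sigma)$ is the number of left-to-right maxima of $\sigma$ (entries $\sigma_i$ with $\sigma_i>\sigma_j$ for all $j<i$), and $S_n(\tau;\mathrm{LR}_n<\delta n)$ is the set of $\sigma\in S_n(\tau)$ with $\mathrm{LR}_n(\sigma)<\delta n$. *)

(* Defs.v *)
From mathcomp Require Export all_boot all_order all_fingroup all_algebra.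
From mathcomp Require Export all_classical all_reals all_analysis.
Export Order.TTheory GRing.Theory Num.Theory.
Export numFieldNormedType.Exports.

Set Implicit Arguments.
Unset Strict Implicit.
Unset Printing Implicit Defensive.

(* Positions and values are 0-indexed: the entry sigma_(i+1) is (sigma i) + 1. *)

Definition contains_pattern (n k : nat) (sigma : 'S_n) (tau : 'S_k) : bool :=
  [exists f : {ffun 'I_k -> 'I_n},
    [forall i : 'I_k, [forall j : 'I_k, (i < j)%N ==> (f i < f j)%N]] &&
    [forall i : 'I_k, [forall j : 'I_k,
       (sigma (f i) < sigma (f j))%N == (tau i < tau j)%N]]].

Definition avoiders (k : nat) (tau : 'S_k) (n : nat) : {set 'S_n} :=
  [set sigma : 'S_n | ~~ contains_pattern sigma tau].

Definition lr_maxima (n : nat) (sigma : 'S_n) : {set 'I_n} :=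
  [set i : 'I_n | [forall j : 'I_n, (j < i)%N ==> (sigma j < sigma i)%N]].

Definition avoiders_few_lr (R : realType) (k : nat) (tau : 'S_k) (delta : R)
    (n : nat) : {set 'S_n} :=
  [set sigma in avoiders tau n | (#|lr_maxima sigma|%:R < delta * n%:R)%R].

Definition nth_root_card (R : realType) (n : nat) (A : {set 'S_n}) : R :=
  powR (#|A|%:R)%R (n%:R^-1)%R.

Definition growth_rate (R : realType) (k : nat) (tau : 'S_k) : R :=
  limn (fun n => nth_root_card R (avoiders tau n)).

(* Main.v *)
Require Import Defs.
From mathcomp Require Import zify lra.

(** Since [tau] starts with its maximum, inserting an entry just above the
    current prefix maximum, at any of the [n + 1] positions, keeps a permutation
    [tau]-avoiding and creates one new left-to-right maximum.  A permutation
    with at most [m + 1] left-to-right maxima arises at most [m + 1] times, so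
    each insertion multiplies the count by at least [(n + 1) / (m + 1)].  After
    [n / q] insertions starting from [m < delta * n], this gives
    [|S_n(tau; LR < delta n)| <= (delta + 1/q)^(n/q) * |S_(n + n/q)(tau)|];
    for [delta + 1/q < 1/L] the right-hand side is exponentially smaller than
    [L^n]. *)

Set Implicit Arguments.
Unset Strict Implicit.
Unset Printing Implicit Defensive.

Local Open Scope ring_scope.

(** * Inserting a record into a permutation *)

Lemma ltn_lift n (h : 'I_n.+1) (a b : 'I_n) :
  (lift h a < lift h b)%N = (a < b)%N.
Proof. by rewrite !ltnNge leq_bump2. Qed.

Lemma lift_ltn n (h : 'I_n.+1) (a : 'I_n) : (lift h a < h)%N = (a < h)%N.
Proof. by rewrite /= /bump; lia. Qed.

Lemma ltn_lift_self n (h : 'I_n.+1) (a : 'I_n) :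
  (h < lift h a)%N = (h <= a)%N.
Proof. by rewrite /= /bump; lia. Qed.

(* The least value exceeding every entry of [sigma] at a position before [i]. *)
Definition record_value n (i : 'I_n.+1) (sigma : 'S_n) : 'I_n.+1 :=
  inord (\max_(l < n | (l < i)%N) (sigma l).+1)%N.

Definition insert_record n (i : 'I_n.+1) (sigma : 'S_n) : 'S_n.+1 :=
  lift_perm i (record_value i sigma) sigma.

Lemma record_valueE n (i : 'I_n.+1) (sigma : 'S_n) :
  record_value i sigma = (\max_(l < n | (l < i)%N) (sigma l).+1)%N :> nat.
Proof. by rewrite inordK // ltnS; apply/bigmax_leqP => l _; apply: ltn_ord. Qed.

Lemma record_value_gt n (i : 'I_n.+1) (sigma : 'S_n) (l : 'I_n) :
  (l < i)%N -> (sigma l < record_value i sigma)%N.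
Proof. by move=> li; rewrite record_valueE; apply: leq_bigmax_cond. Qed.

Lemma record_value_attained n (i : 'I_n.+1) (sigma : 'S_n) :
  (0 < i)%N ->
  exists2 l : 'I_n, (l < i)%N & record_value i sigma = (sigma l).+1 :> nat.
Proof.
move=> i0; have n0 : (0 < n)%N by have := ltn_ord i; lia.
have [] := @eq_bigmax_cond _ [pred l : 'I_n | (l < i)%N]
  (fun l => (sigma l).+1).
  by apply/card_gt0P; exists (Ordinal n0).
by move=> l li E; exists l; rewrite // record_valueE -E.
Qed.

(** With [i] fixed, the inserted value can be read off at position [i]; deleting it recovers
    [sigma]. *)
Lemma insert_record_inj n (i : 'I_n.+1) : injective (insert_record i).
Proof.
move=> s t E; apply/permP => l.
have := congr1 (fun p : 'S_n.+1 => p i) E; rewrite /insert_record !lift_perm_id.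
have := congr1 (fun p : 'S_n.+1 => p (lift i l)) E.
by rewrite /insert_record !lift_perm_lift => + Ej; rewrite Ej => /lift_inj.
Qed.

Lemma insert_record_lr n (i : 'I_n.+1) (sigma : 'S_n) :
  i \in lr_maxima (insert_record i sigma).
Proof.
rewrite inE; apply/forallP => j; apply/implyP.
rewrite /insert_record lift_perm_id.
case: (unliftP i j) => [l|] -> ; last by rewrite ltnn.
by rewrite lift_perm_lift !lift_ltn; apply: record_value_gt.
Qed.

(** Deleting position [i] preserves the relative order of the other entries, so any other
    left-to-right maximum comes from one of [sigma]. *)
Lemma card_lr_insert_record n (i : 'I_n.+1) (sigma : 'S_n) :
  (#|lr_maxima (insert_record i sigma)| <= #|lr_maxima sigma|.+1)%N.
Proof.
rewrite -(card_imset _ (@lift_inj _ i)).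
apply: (@leq_trans #|i |: (lift i @: lr_maxima sigma)|); last first.
  by rewrite cardsU1; case: (_ \notin _).
apply/subset_leq_card/fintype.subsetP => j; rewrite inE => /forallP lrj.
rewrite !inE; case: (unliftP i j) lrj => [l|] -> lrj; last by rewrite eqxx.
apply/orP; right; apply: imset_f; rewrite inE; apply/forallP => m.
have := lrj (lift i m).
by rewrite ltn_lift /insert_record !lift_perm_lift ltn_lift.
Qed.

Lemma contains_patternP n k (sigma : 'S_n) (tau : 'S_k) :
  reflect (exists2 f : 'I_k -> 'I_n,
             {homo f : i j / (i < j)%N} &
             forall i j, (sigma (f i) < sigma (f j))%N = (tau i < tau j)%N)
          (contains_pattern sigma tau).
Proof.
apply: (iffP existsP) => [[f /andP[/forallP H1 /forallP H2]]|[f H1 H2]].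
  exists f => i j; first by move/forallP: (H1 i) => /(_ j)/implyP.
  by move/forallP: (H2 i) => /(_ j)/eqP.
exists (finfun f); apply/andP; split; apply/forallP => i; apply/forallP => j.
  by apply/implyP; rewrite !ffunE; apply: H1.
by rewrite !ffunE; apply/eqP.
Qed.

Lemma contains_pattern1 n (sigma : 'S_n) (tau : 'S_1) :
  (0 < n)%N -> contains_pattern sigma tau.
Proof.
move=> n0; apply/contains_patternP; exists (fun=> Ordinal n0) => i j.
  by rewrite !ord1.
by rewrite !ord1 !ltnn.
Qed.

(* A left-to-right maximum can only play the role of the leading maximum of
   [tau]; in that role the inserted record can be replaced by the previous
   one, so that no new occurrence of [tau] is created. *)
Lemma contains_insert_record n k (tau : 'S_k.+1) (i : 'I_n.+1) (sigma : 'S_n) :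
  tau ord0 = ord_max -> (0 < n)%N ->
  contains_pattern (insert_record i sigma) tau -> contains_pattern sigma tau.
Proof.
move=> htau n0; set pi := insert_record i sigma.
(* For a pattern of length one, [ord0] is also the last index, so no smaller entry follows the
   maximum; this case is settled by [0 < n]. *)
case: k tau htau => [tau _ _|k tau htau]; first exact: contains_pattern1.
have tau_max a : a != ord0 -> (tau a < tau ord0)%N.
  move=> a0; rewrite htau ltn_neqAle -ltnS ltn_ord andbT.
  by apply: contra a0 => /eqP E; apply/eqP/(@perm_inj _ tau)/val_inj; rewrite htau.
have piL l : pi (lift i l) = lift (record_value i sigma) (sigma l).
  exact: lift_perm_lift.
have piI : pi i = record_value i sigma by apply: lift_perm_id.
case/contains_patternP=> f f_homo f_tau; apply/contains_patternP.
have role a : f a = i -> a = ord0.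
  move=> fa; apply/eqP/negPn/negP => a0.
  have : (f ord0 < f a)%N by apply: f_homo; rewrite lt0n.
  have := insert_record_lr i sigma; rewrite inE => /forallP/(_ (f ord0)).
  rewrite fa => /implyP H /H; rewrite -/pi -fa f_tau.
  by have := tau_max a a0; lia.
case: (eqVneq (f ord0) i) => [f0|f0]; last first.
  have ex a : exists l, f a = lift i l.
    case: (unliftP i (f a)) => [l ->|fa]; first by exists l.
    by move: f0; rewrite -(role _ fa) fa eqxx.
  have [g gE] := choice ex.
  exists g => [a b|a b]; first by move=> /f_homo; rewrite !gE ltn_lift.
  by rewrite -f_tau !gE !piL ltn_lift.
(* At position 0 the record would have value 0, yet the occurrence has an entry below it. *)
have i0 : (0 < i)%N.
  have : (pi (f ord_max) < pi i)%N by rewrite -f0 f_tau tau_max.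
  case: (ltnP 0 i) => // i0; rewrite piI record_valueE big_pred0 // => l.
  by apply/negbTE; rewrite -leqNgt (leq_trans i0).
have [l0 l0i l0E] := record_value_attained sigma i0.
(* The new occurrence [g] starts at the previous record [l0] and keeps the other entries of [f]. *)
have ex a : exists l, if a == ord0 then l = l0 else f a = lift i l.
  case: eqVneq => [_|a0]; first by exists l0.
  case: (unliftP i (f a)) => [l ->|fa]; first by exists l.
  by case/eqP: a0; apply: role.
have [g gE] := choice ex.
have g0 : g ord0 = l0 by have := gE ord0.
have gS a : a != ord0 -> f a = lift i (g a).
  by move=> a0; have := gE a; rewrite (negbTE a0).
have gi a : a != ord0 -> (i <= g a)%N.
  move=> a0; rewrite -ltn_lift_self -gS // -f0; apply: f_homo.
  by rewrite lt0n.
(* Being below the record means being at most [sigma l0]; equality would force [g a = l0], but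
   [l0 < i <= g a]. *)
have glt a : a != ord0 -> (sigma (g a) < sigma l0)%N.
  move=> a0; have := tau_max a a0; rewrite -f_tau f0 piI gS // piL lift_ltn.
  rewrite l0E ltnS leq_eqVlt => /orP[/eqP/val_inj/perm_inj E|//].
  by have := gi a a0; rewrite E leqNgt l0i.
exists g => a b.
  case: (eqVneq a ord0) => [->|a0]; case: (eqVneq b ord0) => [->|b0] //.
  - by move=> _; rewrite g0; apply: leq_trans (gi b b0).
  - by move=> /f_homo; rewrite !gS // ltn_lift.
case: (eqVneq a ord0) => [->|a0]; case: (eqVneq b ord0) => [->|b0].
- by rewrite !ltnn.
- by rewrite g0; have := glt b b0; have := tau_max b b0; lia.
- by rewrite g0 glt // tau_max.
- by rewrite -f_tau !gS // !piL ltn_lift.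
Qed.

(** * Double counting of insertions *)

Definition avoiders_le_lr k (tau : 'S_k) n m : {set 'S_n} :=
  [set sigma in avoiders tau n | (#|lr_maxima sigma| <= m)%N].

(** The pairs (position, permutation) inject into the pairs (permutation, marked left-to-right
    maximum), the mark being the inserted entry. Each permutation in the target carries at most
    [m.+1] marks. *)
Lemma avoiders_le_lr_step k (tau : 'S_k.+1) n m :
  tau ord0 = ord_max -> (0 < n)%N ->
  (n.+1 * #|avoiders_le_lr tau n m| <=
   m.+1 * #|avoiders_le_lr tau n.+1 m.+1|)%N.
Proof.
move=> htau n0; set A := avoiders_le_lr _ n m; set B := avoiders_le_lr _ _ _.
pose h (x : 'I_n.+1 * 'S_n) := (insert_record x.1 x.2, x.1).
have h_inj : injective h.
  by move=> [i s] [j t] [] /= + ij; rewrite ij => /insert_record_inj ->.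
have -> : (n.+1 * #|A|)%N = #|h @: finset.setX (finset.setTfor 'I_n.+1) A|.
  by rewrite card_imset // cardsX cardsT card_ord.
pose D := [set y : 'S_n.+1 * 'I_n.+1 | (y.1 \in B) && (y.2 \in lr_maxima y.1)].
apply: (@leq_trans #|D|).
  apply/subset_leq_card/fintype.subsetP => y.
  move=> /imsetP[[i s] /finset.setXP[_ sA] ->].
  rewrite finset.in_set /= insert_record_lr andbT.
  move: sA; rewrite !inE => /andP[sA sm].
  apply/andP; split; first by apply: contra sA; apply: contains_insert_record.
  by apply: leq_trans (card_lr_insert_record _ _) _.
rewrite -sum1_card (eq_bigl _ _ (finset.in_set _)) /=.
rewrite -(pair_big_dep (mem B) (fun p i => i \in lr_maxima p) (fun _ _ => 1%N)).
rewrite /= mulnC -sum_nat_const; apply: leq_sum => p; rewrite inE => /andP[_].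
by rewrite sum1_card.
Qed.

Lemma avoiders_le_lr_iter k (tau : 'S_k.+1) n m j :
  tau ord0 = ord_max -> (0 < n)%N ->
  (n ^ j * #|avoiders_le_lr tau n m| <=
   (m + j) ^ j * #|avoiders tau (n + j)|)%N.
Proof.
move=> htau n0.
(* Here [j] stays fixed while [i] grows, so that [m + j] bounds every factor [(m + i).+1] and [n] is
   below every [(n + i).+1]. *)
suff H i : (i <= j -> n ^ i * #|avoiders_le_lr tau n m| <=
    (m + j) ^ i * #|avoiders_le_lr tau (n + i) (m + i)|)%N.
  apply: leq_trans (H j (leqnn j)) _; rewrite leq_mul2l subset_leq_card ?orbT //.
  by apply/fintype.subsetP => s; rewrite inE => /andP[].
elim: i => [_|i IH ij]; first by rewrite !addn0.
rewrite !expnS -!mulnA.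
apply: leq_trans (leq_mul (leqnn n) (IH (ltnW ij))) _.
rewrite mulnCA [leqRHS]mulnCA leq_mul2l; apply/orP; right.
rewrite !addnS; apply: (@leq_trans ((n + i).+1 *
   #|avoiders_le_lr tau (n + i) (m + i)|)).
  by rewrite leq_mul2r; apply/orP; right; lia.
apply: leq_trans (avoiders_le_lr_step _ htau _) _; first by lia.
by rewrite leq_mul2r; apply/orP; right; lia.
Qed.

(** * From counts to growth rates *)

Lemma ler_powR_invn (R : realType) (x a : R) n :
  (0 < n)%N -> 0 <= x -> 0 <= a -> (x `^ n%:R^-1 <= a) = (x <= a ^+ n).
Proof.
move=> n0 x0 a0; rewrite -(@ler_pXn2r _ n) ?nnegrE ?powR_ge0 //.
rewrite -(powR_mulrn n (powR_ge0 _ _)) -powRrM mulVf ?pnatr_eq0 -?lt0n //.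
by rewrite powRr1.
Qed.

Lemma exists_root_gt1 (R : realType) (x : R) n :
  1 < x -> (0 < n)%N -> exists2 u, 1 < u & u ^+ n = x.
Proof.
move=> x1 n0; have x0 : 0 <= x by lra.
exists (x `^ n%:R^-1); first by rewrite ltNge ler_powR_invn ?expr1n -?ltNge.
rewrite -(powR_mulrn n (powR_ge0 _ _)) -powRrM mulVf ?pnatr_eq0 -?lt0n //.
by rewrite powRr1.
Qed.

Lemma limn_esup_le_near (R : realType) (u : (\bar R)^nat) (M : \bar R) :
  (\forall n \near \oo%classic, (u n <= M)%E) -> (limn_esup u <= M)%E.
Proof.
move=> uM; apply: (@le_trans _ _ (ereal_sup (u @` [set n | (u n <= M)%E]))).
  by apply: ereal_inf_lbound; exists [set n | (u n <= M)%E]%classic.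
by apply: ge_ereal_sup => _ [n unM <-].
Qed.

Lemma few_lr_bound (R : realType) k (tau : 'S_k.+1) (delta : R) n q :
  tau ord0 = ord_max -> 0 < delta -> (0 < q)%N -> (0 < n)%N ->
  #|avoiders_few_lr tau delta n|%:R <=
  (delta + q%:R^-1) ^+ (n %/ q) * #|avoiders tau (n + n %/ q)|%:R.
Proof.
move=> htau d0 q0 n0; set j := (n %/ q)%N; pose m := Num.truncn (delta * n%:R).
have n0R : 0 < n%:R :> R by rewrite ltr0n.
have q0R : 0 < q%:R :> R by rewrite ltr0n.
have dn0 : 0 <= delta * n%:R by rewrite mulr_ge0 // ltW.
have sub : (#|avoiders_few_lr tau delta n| <= #|avoiders_le_lr tau n m|)%N.
  apply/subset_leq_card/fintype.subsetP => s; rewrite !inE => /andP[-> lrs] /=.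
  by rewrite /m truncn_ge_nat // ltW.
have := leq_trans (leq_mul (leqnn (n ^ j)) sub)
  (avoiders_le_lr_iter m j htau n0).
rewrite -(ler_nat R) !natrM !natrX => H.
rewrite -(ler_pM2l (exprn_gt0 j n0R)); apply: le_trans H _.
rewrite mulrA -exprMn ler_wpM2r // lerXn2r ?nnegrE //.
  by rewrite mulr_ge0 ?addr_ge0 ?invr_ge0 // ltW.
(* Both truncations go the right way: [m <= delta * n] and [j <= n / q]. *)
rewrite natrD mulrDr lerD //; first by rewrite mulrC truncn_le.
by rewrite ler_pdivlMr // -natrM ler_nat leq_divM.
Qed.

(* With [s = u ^ (2q)] and [c = L s ^ (2q+2)], the gain [c ^ j] over [j = n/q]
   insertions beats the error [s ^ (n + j)] because [n <= 2qj]. *)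
Lemma few_lr_growth_bound (R : realType) (L u c F S : R) n q :
  0 < L -> 1 < u -> (0 < q)%N -> (q <= n)%N -> 0 <= F ->
  u ^+ (2 * q * (2 * q + 2)) = c / L ->
  F <= c^-1 ^+ (n %/ q) * S -> S <= (L * u ^+ (2 * q)) ^+ (n + n %/ q) ->
  F <= (L / u) ^+ n.
Proof.
move=> L0 u1 q0 qn F0 uc FS SL; set j := (n %/ q)%N in FS SL *.
have u0 : 0 < u by lra.
set s := u ^+ (2 * q) in SL; have s1 : 1 <= s by rewrite exprn_ege1 // ltW.
have s0 : 0 < s by lra.
have cE : c = L * s ^+ (2 * q + 2).
  by rewrite -exprM uc mulrC divfK // gt_eqF.
have c0 : 0 < c by rewrite cE mulr_gt0 // exprn_gt0.
(* Since [q <= n] gives [1 <= j], one has [n < (j + 1) * q <= 2 * q * j]. *)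
have njq : (n <= 2 * q * j)%N.
  have j0 : (0 < j)%N by rewrite divn_gt0.
  have := ltn_ceil n q0; rewrite -/j; nia.
have {}FS : c ^+ j * F <= (L * s) ^+ (n + j).
  rewrite -ler_pdivlMl ?exprn_gt0 // -exprVn; apply: le_trans FS _.
  by rewrite ler_wpM2l // exprn_ge0 // invr_ge0 ltW.
have {}FS : s ^+ (j + (2 * q * j + j)) * F <= s ^+ (2 * q * j + j) * L ^+ n.
  rewrite -(ler_pM2l (exprn_gt0 j L0)).
  have -> : L ^+ j * (s ^+ (j + (2 * q * j + j)) * F) = c ^+ j * F.
    have -> : (j + (2 * q * j + j) = (2 * q + 2) * j)%N by nia.
    by rewrite mulrA cE exprMn -(exprM s).
  apply: le_trans FS _; rewrite exprMn [s ^+ _ * _]mulrC mulrA -exprD.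
  rewrite [(j + n)%N]addnC ler_pM2l ?exprn_gt0 // ler_weXn2l //; lia.
(* Cancelling the common power leaves [s ^+ j * F <= L ^+ n], and
   [u ^+ n <= u ^+ (2 * q * j) = s ^+ j]. *)
move: FS; rewrite [s ^+ (j + _)]exprD [s ^+ j * _]mulrC -mulrA.
rewrite ler_pM2l ?exprn_gt0 // => FS.
rewrite expr_div_n ler_pdivlMr ?exprn_gt0 // mulrC; apply: le_trans FS.
by rewrite ler_wpM2r // -exprM ler_weXn2l // ltW.
Qed.

Theorem theorem2p5 (R : realType) (k : nat) (tau : 'S_k.+1)
    (htau : tau ord0 = ord_max) (delta : R)
    (hdelta0 : 0 < delta) (hdelta1 : delta < 1 / growth_rate R tau) :
  (limn_esup (fun n => (nth_root_card R (avoiders_few_lr tau delta n))%:E)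
     < (growth_rate R tau)%:E)%E.
Proof.
set L := growth_rate R tau in hdelta1 *.
(* Positivity of [L] is read off from [0 < delta < 1 / L]. *)
have L0 : 0 < L.
  by have := lt_trans hdelta0 hdelta1; rewrite div1r invr_gt0.
have cvgL : ((fun n => nth_root_card R (avoiders tau n)) @ \oo --> L)%classic.
  (* A divergent sequence has the junk limit 0. *)
  have [//|/dvgP L_eq0] :=
    pselect (cvgn (fun n => nth_root_card R (avoiders tau n))).
  by move: L0; rewrite /L /growth_rate L_eq0 ltxx.
have [q q0 q_gap] : exists2 q, (0 < q)%N & q%:R^-1 < 1 / L - delta.
  have gap : 0 < 1 / L - delta by rewrite subr_gt0.
  exists (Num.truncn (1 / L - delta)^-1).+1 => //.
  by rewrite -[ltRHS]invrK ltf_pV2 ?posrE ?invr_gt0 // truncnS_gt.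
have q0R : 0 < q%:R :> R by rewrite ltr0n.
pose c := (delta + q%:R^-1)^-1.
have dq0 : 0 < delta + q%:R^-1 by rewrite addr_gt0 // invr_gt0.
have Lc : L < c.
  by rewrite -[L]invrK ltf_pV2 ?posrE ?invr_gt0 // -(div1r L) addrC -ltrBrDr.
have [||u u1 uc] := @exists_root_gt1 R (c / L) (2 * q * (2 * q + 2)).
- by rewrite ltr_pdivlMr ?mul1r.
- by rewrite !muln_gt0 q0 addn_gt0 orbT.
have u0 : 0 < u by lra.
(* The bound [L / u] holds eventually and is strictly below [L], so the strict inequality survives
   the limsup. *)
apply: (@le_lt_trans _ _ (L / u)%:E); last first.
  by rewrite lte_fin ltr_pdivrMr // ltr_pMr.
apply: limn_esup_le_near.
have Ls : L < L * u ^+ (2 * q) by rewrite ltr_pMr // exprn_egt1 // -lt0n muln_gt0 q0.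
have [N _ SN] := cvgr_lt L cvgL _ Ls.
(* The summand [q] ensures at least one insertion; [N] makes the estimate on avoiders valid at
   length [n + n %/ q]. *)
exists (N + q)%N => // n /= Nqn; have qn : (q <= n)%N by lia.
rewrite lee_fin /nth_root_card ler_powR_invn //; [|lia|by rewrite divr_ge0 ?ltW].
apply: (few_lr_growth_bound (S := #|avoiders tau (n + n %/ q)|%:R)
  L0 u1 q0 qn _ uc) => //.
  by rewrite /c invrK; apply: few_lr_bound => //; lia.
have Nn : (N <= n + n %/ q)%N by apply: leq_trans (leq_addr _ _); lia.
have /ltW := SN _ Nn; rewrite /nth_root_card ler_powR_invn //.
  by rewrite addn_gt0; apply/orP; left; lia.
by rewrite mulr_ge0 ?exprn_ge0 ?ltW.
Qed.
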